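(* Let $d\ge 1$ and let $(X,T,\mathbb{Z}^d)$ be a minimal free topological dynamical system on a compact metrizable space $X$. Then, for any $\varepsilon>0$ and any $N\in\mathbb{N}$ with $N\ge 1$, there is an open set $\Omega\subseteq X$ such that the sets $$T^{-n}(\Omega),\quad n\in\{0,1,\dots,N-1\}^d,$$ are mutually disjoint, and $$\mathrm{ocap}\Big(X\setminus\bigcup_{n\in\{0,1,\dots,N-1\}^d}T^{-n}(\Omega)\Big)<\varepsilon.$$
   Context: $(X,T,\mathbb{Z}^d)$ denotes an action $n\mapsto T^n$ of $\mathbb{Z}^d$ on a nonempty compact metrizable space $X$ by homeomorphisms (so $T^{m+n}=T^m\circ T^n$, $T^0=\mathrm{id}$). It is minimal if $\varnothing$ and $X$ are the only closed sets $Y\subseteq X$ with $T^n(Y)=Y$ for all $n\in\mathbb{Z}^d$; it is free if for every $x\in X$, $\{n\in\mathbb{Z}^d: T^n(x)=x\}=\{0\}$. Orbit capacity. For a subset $E\subseteq X$, $$\mathrm{ocap}(E)=\lim_{N\to\infty}\frac{1}{N^d}\sup_{x\in X}\sum_{n\in\{0,1,\dots,N-1\}^d}\chi_E(T^n(x)),$$ where $\chi_E$ is the characteristic function of $E$ (the limit always exists). *)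

(* Defs.v *)
From HB Require Import structures.
From mathcomp Require Import all_boot all_order all_algebra.
From mathcomp Require Import all_classical all_reals all_analysis.

Set Implicit Arguments.
Unset Strict Implicit.
Unset Printing Implicit Defensive.

Import Order.TTheory GRing.Theory Num.Theory.
Import numFieldNormedType.Exports.

Local Open Scope classical_set_scope.
Local Open Scope ring_scope.

Definition is_metric (R : realType) (X : Type) (dist : X -> X -> R) : Prop :=
  [/\ forall x y, dist x y = 0 <-> x = y,
      forall x y, dist x y = dist y x &
      forall x y z, dist x z <= dist x y + dist y z].

Definition metrizable (R : realType) (X : topologicalType) : Prop :=
  exists dist : X -> X -> R, is_metric dist /\
    forall x : X, nbhs x =
      filter_from [set e : R | 0 < e] (fun e => [set y | dist x y < e]).

Definition homeomorphism (X Y : topologicalType) (f : X -> Y) : Prop :=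
  continuous f /\
  exists g : Y -> X, [/\ continuous g, cancel f g & cancel g f].

(* [T n] is the homeomorphism T^n; in particular T^{-n} is [T (- n)]. *)
Definition Zd_action (d : nat) (X : topologicalType)
    (T : 'rV[int]_d -> X -> X) : Prop :=
  [/\ forall n, homeomorphism (T n),
      forall x, T 0 x = x &
      forall m n x, T (m + n) x = T m (T n x)].

Definition minimal_action (d : nat) (X : topologicalType)
    (T : 'rV[int]_d -> X -> X) : Prop :=
  forall Y : set X, closed Y -> (forall n, T n @` Y = Y) ->
    Y = set0 \/ Y = setT.

Definition free_action (d : nat) (X : Type) (T : 'rV[int]_d -> X -> X) : Prop :=
  forall x, [set n | T n x = x] = [set 0].

(* {0, ..., N-1}^d is represented by the finite type {ffun 'I_d -> 'I_N};
   [cube_pt] is its (injective) inclusion into Z^d. *)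
Definition cube_pt (d N : nat) (n : {ffun 'I_d -> 'I_N}) : 'rV[int]_d :=
  \row_(j < d) (n j : nat)%:Z.

(* The supremum is over a nonempty set of reals bounded by N^d as soon as X is
   nonempty.  The term N = 0 is a junk value, irrelevant to the limit. *)
Definition ocap (R : realType) (d : nat) (X : Type)
    (T : 'rV[int]_d -> X -> X) (E : set X) : R :=
  lim ((fun N : nat =>
    (N%:R ^+ d)^-1 *
    sup (range (fun x : X =>
      \sum_(n : {ffun 'I_d -> 'I_N}) \1_E (T (cube_pt n) x) : R))) @ \oo).

(* Main.v *)
Require Import Defs.
From HB Require Import structures.
From mathcomp Require Import all_boot all_order all_algebra.
From mathcomp Require Import all_classical all_reals all_analysis.
From mathcomp Require Import zify ring lra.

Set Implicit Arguments.
Unset Strict Implicit.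
Unset Printing Implicit Defensive.

Import Order.TTheory GRing.Theory Num.Theory.
Import numFieldNormedType.Exports.

Local Open Scope classical_set_scope.
Local Open Scope ring_scope.

(* Minimality and freeness give a continuous g >= 0 such that the orbit of any
   x visits {g > 0} along a relatively dense but sparse subset of Z^d.  Taking
   g (T^v x) as the weight of the site v, the power diagram of Z^d (the cell of
   u consists of the p at which |p - v|^2 - weight(v) is minimal for v = u)
   depends continuously and equivariantly on x.  Omega is the set of those x
   for which the cube -{0,...,N-1}^d lies strictly inside one cell, whose site
   u moreover belongs to N Z^d: each cell is thus filled with translates of the
   cube, aligned with its site.

   What is missed lies close to cell boundaries.  Let lam = 1 - 1/k.
   Contracting a cell for the weights a by the factor lam towards its site u
   lands well inside the cell of u for the weights lam * a, provided that the
   sites of positive weight are sparse.  Since the cells for a cover Z^d, a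
   proportion about lam^d of Z^d is well inside cells, uniformly in x.  To
   count lattice points instead of volumes, the contraction is rounded with an
   offset i/k in every coordinate, and i is chosen by averaging so as to make
   the rounded contraction injective outside a set of density at most d/k. *)

(** * Power diagrams of Z^d and their contraction *)

Definition sqnorm (R : realType) (d : nat) (p : 'rV[int]_d) : R :=
  \sum_(j < d) (p 0 j)%:~R ^+ 2.

Definition power_dist (R : realType) (d : nat) (a : 'rV[int]_d -> R)
    (v p : 'rV[int]_d) : R :=
  sqnorm R (p - v) - a v.

Definition in_cell (R : realType) (d : nat) (a : 'rV[int]_d -> R)
    (u p : 'rV[int]_d) : Prop :=
  forall v, v != u -> power_dist a u p < power_dist a v p.

(** The offsets [b] are the differences of two points of {0,...,N-1}^d, so every translate of that
    cube containing [p] lies in the cell. *)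
Definition deep_in_cell (R : realType) (d : nat) (a : 'rV[int]_d -> R)
    (N : nat) (u p : 'rV[int]_d) : Prop :=
  forall b : 'rV[int]_d, (forall j, `|b 0 j| < N%:Z) -> in_cell a u (p + b).

Definition box_pt (d B : nat) (f : {ffun 'I_d -> 'I_(B.*2.+1)}) : 'rV[int]_d :=
  \row_(j < d) ((f j : nat)%:Z - B%:Z).

(* The floor of [(1 - 1/k) z + i/k]. *)
Definition shrink (k i : nat) (z : int) : int := z + ((i%:Z - z) %/ k%:Z)%Z.

Section Lattice.
Context {R : realType} {d : nat}.
Implicit Types (a : 'rV[int]_d -> R) (u v p q b : 'rV[int]_d).

Lemma sqnorm_ge0 p : 0 <= sqnorm R p.
Proof. by apply: sumr_ge0 => j _; exact: sqr_ge0. Qed.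

Lemma sqnormN p : sqnorm R (- p) = sqnorm R p.
Proof. by apply: eq_bigr => j _; rewrite mxE rmorphN sqrrN. Qed.

Lemma sqnorm_coord_le p (B : nat) j : sqnorm R p <= B%:R -> `|p 0 j| <= B%:Z.
Proof.
move=> pB.
have : ((p 0 j)%:~R : R) ^+ 2 <= B%:R.
  apply: le_trans pB; rewrite /sqnorm (bigD1 j)//= lerDl.
  by apply: sumr_ge0 => i _; exact: sqr_ge0.
by rewrite -rmorphXn/= -[B%:R]/((B%:Z)%:~R) ler_int; nia.
Qed.

Lemma box_ptP p (B : nat) :
  (forall j, `|p 0 j| <= B%:Z) -> exists f, p = box_pt (B := B) f.
Proof.
move=> pB; exists [ffun j : 'I_d => inord (absz (p 0 j + B%:Z))].
apply/rowP => j; rewrite mxE ffunE inordK; have := pB j; lia.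
Qed.

Lemma power_ge a (B : nat) v p :
  a v <= B%:R -> power_dist a v p < 0 -> sqnorm R (p - v) <= B%:R.
Proof. by rewrite /power_dist subr_lt0 => avB /ltW/le_trans; apply. Qed.

Lemma power_lt0_weight a v p : power_dist a v p < 0 -> 0 < a v.
Proof. by rewrite /power_dist subr_lt0; apply: le_lt_trans; exact: sqnorm_ge0. Qed.

Lemma in_cell_uniq a u v p : in_cell a u p -> in_cell a v p -> u = v.
Proof.
move=> cu cv; apply/eqP/negPn/negP => uv.
by have := lt_trans (cu v _) (cv u uv); rewrite ltxx eq_sym => /(_ uv).
Qed.

(** Sites at negative power distance from [p] lie in a box around [p], so only finitely many
    compete. *)
Lemma power_min a (B : nat) p :
  (forall v, a v <= B%:R) -> (exists v, power_dist a v p < 0) ->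
  exists2 u, power_dist a u p < 0 & forall v, power_dist a u p <= power_dist a v p.
Proof.
move=> aB [v0 v0p].
have box v : power_dist a v p < 0 -> exists f, v = p - box_pt (B := B) f.
  move=> vp; have [|f pf] := @box_ptP (p - v) B.
    by move=> j; exact: sqnorm_coord_le (power_ge (aB v) vp).
  by exists f; rewrite -pf opprB addrCA subrr addr0.
have [f0 f0E] := box v0 v0p.
pose F f := power_dist a (p - box_pt (B := B) f) p.
have [f _ fmin] := @Order.TotalTheory.arg_minP _ _ _ f0 xpredT F isT.
exists (p - box_pt f).
  by apply: le_lt_trans (fmin f0 isT) _; rewrite /F -f0E.
move=> v; have [/box[g ->]|vp] := ltP (power_dist a v p) 0; first exact: fmin.
by apply: le_trans vp; apply: le_trans (fmin f0 isT) _; rewrite /F -f0E ltW.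
Qed.

(* The difference of the power distances to u and v is an affine function of
   the point, so the inequality at p (for the weights a) and the separation of
   u and v (which makes the difference at u large for the zero weight) combine
   linearly at points near u + lam (p - u), for the weights lam * a. *)
Lemma power_contract a (k : nat) (c lam : R) u v p q :
  (0 < k)%N -> lam = 1 - k%:R^-1 -> 0 <= c -> 0 <= lam ->
  (forall j, `|(q 0 j - u 0 j)%:~R - lam * (p 0 j - u 0 j)%:~R| <= c) ->
  4 * d%:R * (k%:R * c) ^+ 2 < sqnorm R (u - v) ->
  power_dist a u p <= power_dist a v p ->
  power_dist (fun w => lam * a w) u q < power_dist (fun w => lam * a w) v q.
Proof.
move=> k0 lamE c0 lam0 qp sep; rewrite /power_dist => up.
have kR : 0 < k%:R :> R by rewrite ltr0n.
set K : R := k%:R^-1; have K0 : 0 < K by rewrite invr_gt0.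
have kK : k%:R * K = 1 by rewrite divff// gt_eqF.
have key : sqnorm R (q - v) - sqnorm R (q - u) >=
    lam * (sqnorm R (p - v) - sqnorm R (p - u)) +
    (K / 2 * sqnorm R (u - v) - \sum_(j < d) 2 * k%:R * c ^+ 2).
  rewrite /sqnorm -!sumrB !mulr_sumr -sumrB -big_split/=.
  apply: ler_sum => j _; rewrite !mxE !rmorphB/=; have := qp j.
  rewrite !rmorphB/=.
  set Q := (q 0 j)%:~R; set U := (u 0 j)%:~R; set V := (v 0 j)%:~R.
  set P := (p 0 j)%:~R.
  set be := (Q - U - lam * (P - U)) => bec.
  have be2 : be ^+ 2 <= c ^+ 2 by rewrite -[be ^+ 2]real_normK ?num_real// lerXn2r ?nnegrE.
  have -> : Q = be + U + lam * (P - U) by rewrite /be; ring.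
  (* Half of K (U - V)^2, where K = 1 - lam, absorbs the cross term 2 be (U - V) at the cost of 2 k
     be^2. *)
  have sq0 : 0 <= K / 2 * (U - V + 2 * k%:R * be) ^+ 2.
    by rewrite mulr_ge0 ?sqr_ge0// divr_ge0// ltW.
  have : k%:R * be ^+ 2 <= k%:R * c ^+ 2 by rewrite ler_pM2l.
  have e : K / 2 * (U - V + 2 * k%:R * be) ^+ 2 =
    K / 2 * (U - V) ^+ 2 + 2 * be * (U - V) * (k%:R * K) + 2 * (k%:R * K) * (k%:R * be ^+ 2).
    by field.
  rewrite kK in e.
  move: sq0; rewrite e lamE -/K. nra.
have : K / 2 * (4 * d%:R * (k%:R * c) ^+ 2) < K / 2 * sqnorm R (u - v).
  by rewrite ltr_pM2l// divr_gt0.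
have -> : K / 2 * (4 * d%:R * (k%:R * c) ^+ 2) =
    d%:R * 2 * (k%:R * K) * k%:R * c ^+ 2 by field.
rewrite kK sumr_const card_ord -mulr_natl in key *.
have := ler_wpM2l lam0 up.
lra.
Qed.

End Lattice.

(** * Rounding of integers and counting in finite boxes *)

(** If i - z = q k + r, then i - [shrink k i z] = q (k - 1) + r. This determines q and r once r is
    confined to 1,...,k-1. *)
Lemma shrink_inj (k i : nat) (y z : int) : (1 < k)%N ->
  ~~ (k%:Z %| i%:Z - y)%Z -> ~~ (k%:Z %| i%:Z - z)%Z ->
  shrink k i y = shrink k i z -> y = z.
Proof.
move=> k1 /dvdzP ky /dvdzP kz; rewrite /shrink => e.
have k0 : k%:Z != 0 by lia.
have ey := divz_eq (i%:Z - y) k%:Z; have ez := divz_eq (i%:Z - z) k%:Z.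
have ry : ((i%:Z - y) %% k%:Z)%Z != 0.
  by apply/eqP => ry; apply: ky; exists ((i%:Z - y) %/ k%:Z)%Z; rewrite {1}ey ry addr0.
have rz : ((i%:Z - z) %% k%:Z)%Z != 0.
  by apply/eqP => rz; apply: kz; exists ((i%:Z - z) %/ k%:Z)%Z; rewrite {1}ez rz addr0.
have := modz_ge0 (i%:Z - y) k0; have := modz_ge0 (i%:Z - z) k0.
have kp : 0 < k%:Z by lia.
have := ltz_pmod (i%:Z - y) kp; have := ltz_pmod (i%:Z - z) kp.
move: ey ez e ry rz.
move: ((i%:Z - y) %% k%:Z)%Z ((i%:Z - z) %% k%:Z)%Z => r s.
move: ((i%:Z - y) %/ k%:Z)%Z ((i%:Z - z) %/ k%:Z)%Z => q t.
move=> ey ez e r0 s0 sk rk s00 r00.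
have qt : q = t by nia.
by move: ey ez e; rewrite qt; lia.
Qed.

Lemma shrink_near (R : realType) (k i : nat) (z : int) : (i < k)%N ->
  `|(shrink k i z)%:~R - (1 - k%:R^-1) * z%:~R| <= 1 :> R.
Proof.
move=> ik; rewrite /shrink.
have k0 : k%:Z != 0 by lia.
have kp : 0 < k%:Z by lia.
have := modz_ge0 (i%:Z - z) k0; have := ltz_pmod (i%:Z - z) kp.
have := divz_eq (i%:Z - z) k%:Z.
move: ((i%:Z - z) %% k%:Z)%Z ((i%:Z - z) %/ k%:Z)%Z => r q e rk r0.
have kR : 0 < k%:R :> R by rewrite ltr0n; lia.
have -> : z = i%:Z - q * k%:Z - r by lia.
have -> : (i%:Z - q * k%:Z - r + q)%:~R - (1 - k%:R^-1) * (i%:Z - q * k%:Z - r)%:~R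
   = (i%:Z - r)%:~R / k%:R :> R.
  rewrite !(rmorphD, rmorphB, rmorphM)/= -!pmulrn; field.
  by rewrite gt_eqF.
rewrite normrM normfV (gtr0_norm kR) ler_pdivrMr// mul1r.
by rewrite -intr_norm pmulrn ler_int; lia.
Qed.

Lemma shrink_dist (k i : nat) (z : int) (B : nat) : (i < k)%N -> `|z| <= B%:Z ->
  `|shrink k i z - z| <= (B + k)%:Z.
Proof.
move=> ik zB; rewrite /shrink addrAC subrr add0r.
have k0 : k%:Z != 0 by lia.
have kp : 0 < k%:Z by lia.
have := modz_ge0 (i%:Z - z) k0; have := ltz_pmod (i%:Z - z) kp.
have := divz_eq (i%:Z - z) k%:Z.
move: ((i%:Z - z) %% k%:Z)%Z ((i%:Z - z) %/ k%:Z)%Z => r q e rk r0.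
nia.
Qed.

Definition shrink_pt (d k i : nat) (u p : 'rV[int]_d) : 'rV[int]_d :=
  \row_(j < d) (u 0 j + shrink k i (p 0 j - u 0 j)).

(** Swapping the coordinate [p j] with a free element of ['I_n] is injective on pairs. *)
Lemma card_ffun_coord (d n s : nat) (j : 'I_d) (S : pred 'I_n) :
  (#|S| <= s)%N ->
  (n * #|[set p : {ffun 'I_d -> 'I_n} | S (p j)]%SET| <= s * n ^ d)%N.
Proof.
move=> Ss.
pose h (x : {ffun 'I_d -> 'I_n} * 'I_n) : 'I_n * {ffun 'I_d -> 'I_n} :=
  (x.1 j, [ffun l => if l == j then x.2 else x.1 l]).
have hinj : injective h.
  move=> [p t] [p' t'] [e1 /ffunP e2]; congr pair.
    apply/ffunP => l; have := e2 l; rewrite !ffunE.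
    by case: eqP => [->|].
  by have := e2 j; rewrite !ffunE eqxx.
have -> : (n ^ d = #|[set: {ffun 'I_d -> 'I_n}]%SET|)%N.
  by rewrite cardsT card_ffun !card_ord.
apply: (@leq_trans (#|[set x | S x]%SET| * #|[set: {ffun 'I_d -> 'I_n}]%SET|)); last first.
  rewrite leq_mul2r (leq_trans _ Ss) ?orbT// cardsE.
  exact: eq_leq (eq_card _).
rewrite -cardsX mulnC -[X in (_ * X <= _)%N](card_ord n) -cardsT -cardsX -(card_imset _ hinj).
apply: subset_leq_card; apply/fintype.subsetP => x /imsetP[[p t]].
by rewrite !inE !andbT => pS ->.
Qed.

Lemma card_ord_ends (n D : nat) :
  (#|[pred t : 'I_n | ~~ (D <= t < n - D)]| <= D.*2)%N.
Proof.
rewrite cardE -(size_map (@nat_of_ord n)).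
have -> : (D.*2 = size (iota 0 D ++ iota (n - D) D))%N.
  by rewrite size_cat !size_iota addnn.
apply: uniq_leq_size; first by rewrite (map_inj_uniq val_inj) enum_uniq.
move=> _ /mapP[t + ->]; rewrite mem_enum inE mem_cat !mem_iota.
by have := ltn_ord t; lia.
Qed.

Lemma card_exists_le (I T : finType) (Q : I -> pred T) :
  (#|[pred p | [exists j, Q j p]]| <= \sum_j #|[pred p | Q j p]|)%N.
Proof.
rewrite -sum1_card big_mkcond/=.
under [leqRHS]eq_bigr do rewrite -sum1_card big_mkcond.
rewrite exchange_big; apply: leq_sum => p _.
rewrite inE; case: ifPn => // /existsP[j Qj].
by rewrite (bigD1 j)//= inE Qj.
Qed.

(** * Density of the points deep inside cells *)

Section Counting.
Context {R : realType} {d : nat}.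
Implicit Types (u v p q b : 'rV[int]_d).
Variables (a : 'rV[int]_d -> R) (k N B : nat).
Let lam : R := 1 - k%:R^-1.
Let b_ w := lam * a w.
Hypothesis k_gt1 : (1 < k)%N.
Hypothesis N_gt0 : (0 < N)%N.
Hypothesis a_ge0 : forall v, 0 <= a v.
Hypothesis a_le : forall v, a v <= B%:R.
Hypothesis a_cov : forall p, exists v, power_dist b_ v p < 0.
Hypothesis a_sep : forall u v, 0 < a u -> 0 < a v -> u != v ->
  4 * d%:R * (k%:R * N.+1%:R) ^+ 2 < sqnorm R (u - v).

Let lam_gt0 : 0 < lam.
Proof. by rewrite subr_gt0 invf_lt1 ?ltr1n// ltr0n; lia. Qed.

Let lam_le1 : lam <= 1.
Proof. by rewrite gerBl invr_ge0. Qed.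

Let power_scale v p : power_dist a v p <= power_dist b_ v p.
Proof. by rewrite lerB// ler_piMl. Qed.

Let a_min p : exists2 u, power_dist a u p < 0 & forall v, power_dist a u p <= power_dist a v p.
Proof.
apply: power_min a_le _; have [v vp] := a_cov p.
by exists v; exact: le_lt_trans (power_scale _ _) vp.
Qed.

(** Sites of positive weight lose to [u] by [power_contract], where c = N + 1 covers the rounding
    error 1 and the offset [b]. By [a_cov] the power distance to [u] is then negative, which rules
    out sites of weight 0. *)
Lemma deep_shrink_pt (i : nat) u p : (i < k)%N ->
  power_dist a u p < 0 -> (forall v, power_dist a u p <= power_dist a v p) ->
  deep_in_cell b_ N u (shrink_pt k i u p).
Proof.
move=> ik up0 up b bN.
have site v : 0 < a v -> v != u ->
    power_dist b_ u (shrink_pt k i u p + b) < power_dist b_ v (shrink_pt k i u p + b).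
  move=> av vu; apply: (@power_contract _ _ a k N.+1%:R lam u v p) => //.
  - lia.
  - exact: ltW.
  - move=> j; rewrite !mxE; move: (shrink_near R (p 0 j - u 0 j) ik).
    move: (shrink k i _) => s sE.
    have -> : u 0 j + s + b 0 j - u 0 j = b 0 j + s by ring.
    rewrite rmorphD/= -addrA (le_trans (ler_normD _ _))// -natr1 lerD//.
    by rewrite -intr_norm pmulrn ler_int ltW.
  - by apply: a_sep => //; [exact: power_lt0_weight up0|rewrite eq_sym].
move=> v vu; have [av|av] := ltP 0 (a v); first exact: site.
have [v0 v00] := a_cov (shrink_pt k i u p + b).
have av0 : 0 < a v0 by have := power_lt0_weight v00; rewrite pmulr_rgt0.
have : power_dist b_ u (shrink_pt k i u p + b) < 0.
  have [v0E|v0u] := eqVneq v0 u; first by move: v00; rewrite v0E.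
  exact: lt_trans (site v0 av0 v0u) v00.
move=> /lt_le_trans; apply; rewrite /power_dist.
have -> : b_ v = 0.
  have /le_anti : 0 <= a v <= 0 by rewrite a_ge0.
  by rewrite /b_ => <-; rewrite mulr0.
by rewrite subr0; exact: sqnorm_ge0.
Qed.

Variable n : nat.
Hypothesis n_gt0 : (0 < n)%N.
Let box : finType := {ffun 'I_d -> 'I_n}.
(** Bounds the displacement of each coordinate under the rounded contraction, so that [inside]
    points stay in the box. *)
Let D := (B + k)%N.
Let inside (p : box) := [forall j, (D <= p j < n - D)%N].
Let deep (q : box) := `[< exists u, deep_in_cell b_ N u (cube_pt q) >].

Let card_outside :
  (n * #|[pred p | ~~ inside p]| <= d * D.*2 * n ^ d)%N.
Proof.
have -> : #|[pred p | ~~ inside p]| =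
    #|[pred p : box | [exists j, ~~ (D <= p j < n - D)%N]]|.
  by apply: eq_card => p; rewrite !inE negb_forall.
apply: (leq_trans (leq_mul (leqnn n) (card_exists_le _))).
rewrite big_distrr/= -mulnA -[X in (_ <= X * _)%N](card_ord d) -sum_nat_const.
apply: leq_sum => j _; rewrite -cardsE.
exact: (card_ffun_coord j (card_ord_ends n D)).
Qed.

Section Rounding.
Variable U : 'rV[int]_d -> 'rV[int]_d.
Hypothesis U_lt0 : forall p, power_dist a (U p) p < 0.
Hypothesis U_min : forall p v, power_dist a (U p) p <= power_dist a v p.

Let collides i (p : box) :=
  [exists j, (k%:Z %| (i%:Z - (cube_pt p 0 j - U (cube_pt p) 0 j))%R)%Z].

(** For given [p] and [j] at most one residue [i] modulo k collides; hence the counts for all [i]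
    add up to at most d n^d. *)
Let exists_few_collisions :
  exists2 i, (i < k)%N & (k * #|[pred p | collides i p]| <= d * n ^ d)%N.
Proof.
have tot : (\sum_(i < k) #|[pred p | collides i p]| <= d * n ^ d)%N.
  under eq_bigr do rewrite -sum1_card big_mkcond/=.
  rewrite exchange_big/=.
  have -> : (d * n ^ d = \sum_(p : box) d)%N.
    by rewrite sum_nat_const card_ffun !card_ord mulnC.
  apply: leq_sum => p _.
  rewrite -big_mkcond sum1_card.
  apply: (leq_trans (card_exists_le _)).
  rewrite -[X in (_ <= X)%N](card_ord d) -sum1_card; apply: leq_sum => j _.
  apply/card_le1_eqP => s t; rewrite !inE => /dvdzP[x sx] /dvdzP[y ty].
  apply/val_inj => /=; have := ltn_ord s; have := ltn_ord t.
  have : (s : nat)%:Z - (t : nat)%:Z = (x - y) * k%:Z by lia.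
  have [->|[?|?]] : x = y \/ x + 1 <= y \/ y + 1 <= x by lia.
  - lia.
  - nia.
  - nia.
apply: contrapT => no.
have : (\sum_(i < k) (d * n ^ d).+1 <= \sum_(i < k) k * #|[pred p | collides i p]|)%N.
  apply: leq_sum => i _; rewrite ltnNge; apply/negP => le.
  by apply: no; exists i.
rewrite -big_distrr/= sum_nat_const card_ord.
by rewrite leq_mul2l leqNgt ltnS tot orbF; lia.
Qed.

(** The rounded contraction injects the non-colliding inside points into the deep ones: the cell of
    the image recovers the site, and [shrink_inj] then recovers each coordinate. *)
Let card_not_deep_round i : (i < k)%N ->
  (#|[pred q | ~~ deep q]| <=
   #|[pred p | collides i p]| + #|[pred p | ~~ inside p]|)%N.
Proof.
move=> ik.
pose phi (p : box) := shrink_pt k i (U (cube_pt p)) (cube_pt p).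
(* The default [p j] is never reached on [inside] points, by [hE]. *)
pose h (p : box) : box := [ffun j => insubd (p j) (absz (phi p 0 j))].
pose A := [set p | ~~ collides i p && inside p]%SET.
have hE (p : box) : inside p -> cube_pt (h p) = phi p.
  move=> /forallP pin; apply/rowP => j; rewrite mxE ffunE.
  have : `|phi p 0 j - (p j : nat)%:Z| <= D%:Z.
    have zB : `|cube_pt p 0 j - U (cube_pt p) 0 j| <= B%:Z.
      have := @sqnorm_coord_le R d (cube_pt p - U (cube_pt p)) B j.
      by rewrite !mxE; apply; exact: power_ge (a_le _) (U_lt0 _).
    have := shrink_dist ik zB; rewrite /phi /D !mxE.
    move: (shrink _ _ _) => s; congr (`|_| <= _); ring.
  have := pin j; rewrite val_insubd; case: ifPn; lia.
have Adeep (p : box) : p \in A -> deep (h p).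
  rewrite inE => /andP[_ /hE hp]; apply/asboolP; exists (U (cube_pt p)).
  by rewrite hp; exact: deep_shrink_pt.
have hinj : {in A &, injective h}.
  move=> p q pA qA hpq.
  have cellU r : r \in A -> in_cell b_ (U (cube_pt r)) (cube_pt (h r)).
    rewrite inE => /andP[_ /hE ->].
    have := deep_shrink_pt ik (U_lt0 (cube_pt r)) (U_min (cube_pt r)).
    move=> /(_ 0); rewrite addr0; apply => j.
    by rewrite mxE normr0 ltz_nat.
  have Upq : U (cube_pt p) = U (cube_pt q).
    by apply: in_cell_uniq (cellU p pA) _; rewrite hpq; exact: cellU.
  have : phi p = phi q.
    move: pA qA; rewrite !inE => /andP[_ pi] /andP[_ qi].
    by rewrite -!hE// hpq.
  move=> /rowP phipq; apply/ffunP => j; apply/val_inj.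
  move: pA qA; rewrite !inE => /andP[/existsPn/(_ j) pj _].
  move=> /andP[/existsPn/(_ j) qj _].
  have := phipq j; rewrite !mxE Upq => /addrI.
  rewrite Upq in pj.
  have cE (r : box) : cube_pt r 0 j = (r j : nat)%:Z by rewrite mxE.
  rewrite !cE in pj qj.
  by move=> e; have := shrink_inj k_gt1 pj qj e => /addIr[].
have : (#|A| <= #|[pred q | deep q]|)%N.
  rewrite -(card_in_imset hinj); apply: subset_leq_card.
  apply/fintype.subsetP => _ /imsetP[p pA ->]; exact: Adeep pA.
have eA : (#|A| + #|[pred p | ~~ (~~ collides i p && inside p)]| = #|box|)%N.
  rewrite cardsE -(cardC [pred p | ~~ collides i p && inside p]).
  by congr addn; apply: eq_card => p; rewrite !inE.
have eB : (#|[pred q | deep q]| + #|[pred q | ~~ deep q]| = #|box|)%N.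
  rewrite -(cardC [pred p | deep p]).
  by congr addn; apply: eq_card => p; rewrite !inE.
have : (#|[pred p | ~~ (~~ collides i p && inside p)]| <=
   #|[pred p | collides i p]| + #|[pred p | ~~ inside p]|)%N.
  rewrite -cardUI; apply: leq_trans (leq_addr _ _).
  apply: subset_leq_card; apply/fintype.subsetP => p.
  by rewrite !inE negb_and negbK.
by move: eA eB; lia.
Qed.

Lemma card_not_deep_of_min :
  (n * k * #|[pred q | ~~ deep q]| <= d * n ^ d * n + k * (d * D.*2 * n ^ d))%N.
Proof.
have [i ik Ci] := exists_few_collisions.
have := card_not_deep_round ik; have := card_outside; move: Ci.
move: #|_| #|_| #|_| => z y x Ci yO zxy.
have : (k * (n * y) <= k * (d * D.*2 * n ^ d))%N by rewrite leq_mul2l yO orbT.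
have : (k * x * n <= d * n ^ d * n)%N by rewrite leq_mul2r Ci orbT.
have : (n * k * z <= n * k * (x + y))%N by rewrite leq_mul2l zxy orbT.
nia.
Qed.

End Rounding.

(** The term d/k accounts for collisions, the other for points near the boundary of the box. *)
Lemma card_not_deep :
  #|[pred q | ~~ deep q]|%:R <=
    (d%:R / k%:R + (d * D.*2)%:R / n%:R) * n%:R ^+ d :> R.
Proof.
have exmin p : exists u, power_dist a u p < 0 /\
    forall v, power_dist a u p <= power_dist a v p.
  by have [u] := a_min p; exists u.
have [U UP] := choice exmin.
have := card_not_deep_of_min (fun p => (UP p).1) (fun p => (UP p).2).
move: #|_| => z; rewrite -(ler_nat R).
rewrite !(natrD, natrM, natrX) => H.
have kR : 0 < k%:R :> R by rewrite ltr0n; lia.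
have nR : 0 < n%:R :> R by rewrite ltr0n.
rewrite -(ler_pM2l (mulr_gt0 nR kR)); apply: le_trans H _.
rewrite le_eqVlt; apply/orP; left; apply/eqP; field.
by rewrite !gt_eqF.
Qed.

End Counting.

(** * Equivariant diagrams, the tower and orbit capacity *)

Section Dynamics.
Context {R : realType} {d : nat} {X : topologicalType}.
Variable T : 'rV[int]_d -> X -> X.
Hypothesis T_action : Zd_action T.

Let T_continuous n : continuous (T n).
Proof. by have [/(_ n)[]] := T_action. Qed.

Let T0 x : T 0 x = x.
Proof. by have [_ ->] := T_action. Qed.

Let TD m n x : T (m + n) x = T m (T n x).
Proof. by have [_ _ ->] := T_action. Qed.

(** Equivariance: the diagram of T^m x is that of x translated by -m. *)
Lemma power_shift (c : R) (g : X -> R) m v p x :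
  power_dist (fun w => c * g (T w (T m x))) v p =
  power_dist (fun w => c * g (T w x)) (v + m) (p + m).
Proof. by rewrite /power_dist TD opprD addrACA subrr addr0. Qed.

Section Weights.
Variables (g : X -> R) (lam : R).
Let b x w := lam * g (T w x).
Hypothesis g_cov : forall x, exists n, sqnorm R n < lam * g (T n x).

Lemma power_cover x p : exists v, power_dist (b x) v p < 0.
Proof.
have [n gn] := g_cov (T p x); exists (n + p).
by rewrite /power_dist opprD addrCA subrr addr0 sqnormN subr_lt0 /b TD.
Qed.

Variable B : nat.
Hypothesis g_continuous : continuous g.
Hypothesis b_le : forall x w, b x w <= B%:R.

(** Near [x] the power distance from [p] to [u] stays negative, so only sites in a fixed finite box
    compete, and finitely many continuous strict inequalities remain. *)
Lemma open_in_cell u p : open [set x | in_cell (b x) u p].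
Proof.
have pcont v : continuous (fun x => power_dist (b x) v p).
  move=> x; apply: cvgB; first exact: cvg_cst.
  apply: cvgM; first exact: cvg_cst.
  exact: (continuous_comp (@T_continuous v x) (@g_continuous _)).
rewrite openE => x /= xu.
have up0 : power_dist (b x) u p < 0.
  have [v0 v00] := power_cover x p.
  have [<-//|v0u] := eqVneq v0 u.
  exact: lt_trans (xu v0 v0u) v00.
have near0 : \forall y \near x, power_dist (b y) u p < 0.
  by apply: (@cvgr_lt _ _ _ _ _ _ (pcont u x)).
have nearf : \forall y \near x, forall f : {ffun 'I_d -> 'I_(B.*2.+1)},
    p - box_pt f != u -> power_dist (b y) u p < power_dist (b y) (p - box_pt f) p.
  apply: filter_forall => f.
  have [->|fu] := eqVneq (p - box_pt f) u; first exact: nearW.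
  have : \forall y \near x, 0 < power_dist (b y) (p - box_pt f) p - power_dist (b y) u p.
    apply: (@cvgr_gt _ _ _ _ _ _ (cvgB (pcont _ x) (pcont _ x))).
    by rewrite subr_gt0; exact: xu.
  by apply: filterS => y; rewrite subr_gt0.
apply: filterS2 near0 nearf => y y0 yf v vu.
have [vp|] := ltP (power_dist (b y) v p) 0; last exact: lt_le_trans.
have [|f pf] := @box_ptP d (p - v) B.
  by move=> j; exact: sqnorm_coord_le (power_ge (b_le y v) vp).
have vE : v = p - box_pt f by rewrite -pf opprB addrCA subrr addr0.
by have := yf f; rewrite -vE => /(_ vu).
Qed.

End Weights.

Section Tower.
Variables (g : X -> R) (lam : R) (N : nat).
Let b x w := lam * g (T w x).

(* The cube is negated because a point y of [T (- c) @` Omega] is [T (- c) x]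
   with x in Omega, so that the position 0 of y is the position [- c] of x. *)
Definition tower_base : set X :=
  [set x | exists2 u : 'rV[int]_d, (forall j, (N%:Z %| u 0%R j)%Z) &
    forall c : {ffun 'I_d -> 'I_N}, in_cell (b x) u (- cube_pt c)].

Let in_cell_shift m u p x :
  in_cell (b (T m x)) u p <-> in_cell (b x) (u + m) (p + m).
Proof.
split=> cu v vu.
  have := cu (v - m); rewrite !power_shift subrK; apply.
  by apply: contra_neq vu => <-; rewrite subrK.
by rewrite !power_shift; apply: cu; rewrite (inj_eq (addIr _)).
Qed.

(** If y is in the levels c and c', its position 0 lies in the cells of u + c and u' + c'. These
    sites coincide, and reduction modulo N gives c = c'. *)
Lemma trivIset_tower :
  trivIset [set: {ffun 'I_d -> 'I_N}] (fun n => T (- cube_pt n) @` tower_base).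
Proof.
move=> c c' _ _ [y [[x [u uN cx] xy] [x' [u' uN' cx'] xy']]].
have TK n z w : T (- n) z = w -> z = T n w.
  by move=> <-; rewrite -TD subrr T0.
move/TK in xy; move/TK in xy'; subst x x'.
have := cx c; have := cx' c'; rewrite !in_cell_shift !addNr => h' h.
have e := in_cell_uniq h h'.
apply/ffunP => j; apply/val_inj => /=.
have /rowP/(_ j) := e; rewrite !mxE.
have /dvdzP[s sE] := uN j; have /dvdzP[t tE] := uN' j.
rewrite sE tE; have := ltn_ord (c j); have := ltn_ord (c' j).
move: (nat_of_ord (c j)) (nat_of_ord (c' j)) => m m' m'N mN E.
have [ts|[?|?]] : t = s \/ s + 1 <= t \/ t + 1 <= s by lia.
- by move: E; rewrite ts; lia.
- by nia.
- by nia.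
Qed.

(** The level containing [x] is the residue c of [u] modulo N: seen from T^c x the site becomes u -
    c, which is in N Z^d. *)
Lemma deep_in_tower (N_gt0 : (0 < N)%N) u x :
  deep_in_cell (b x) N u 0 ->
  (\bigcup_(n in [set: {ffun 'I_d -> 'I_N}]) (T (- cube_pt n) @` tower_base)) x.
Proof.
move=> deep.
have N0 : N%:Z != 0 by lia.
have Np : 0 < N%:Z by lia.
have mN j : (absz (u 0%R j %% N%:Z)%Z < N)%N.
  by have := modz_ge0 (u 0 j) N0; have := ltz_pmod (u 0 j) Np; lia.
pose c : {ffun 'I_d -> 'I_N} := [ffun j => Ordinal (mN j)].
have cE j : cube_pt c 0 j = (u 0%R j %% N%:Z)%Z.
  rewrite mxE ffunE /=; have := modz_ge0 (u 0 j) N0; lia.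
exists c => //; exists (T (cube_pt c) x); last by rewrite -TD addNr T0.
exists (u - cube_pt c).
  move=> j; rewrite mxE [X in _ + X]mxE cE.
  by rewrite {1}(divz_eq (u 0 j) N%:Z) addrK dvdz_mull.
move=> e; apply/in_cell_shift; rewrite subrK.
have := deep (- cube_pt e + cube_pt c); rewrite add0r; apply => j.
by rewrite !mxE; have := ltn_ord (c j); have := ltn_ord (e j); lia.
Qed.

Lemma deep_shift (m u : 'rV[int]_d) x :
  deep_in_cell (b x) N u m -> deep_in_cell (b (T m x)) N (u - m) 0.
Proof.
by move=> deep c cN; apply/in_cell_shift; rewrite subrK add0r addrC; exact: deep.
Qed.

End Tower.

Lemma ocap_lt (E : set X) (delta eps : R) (n0 : nat) : [set: X] !=set0 ->
  0 < eps -> delta < eps ->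
  (forall n x, (n0 <= n)%N ->
    \sum_(q : {ffun 'I_d -> 'I_n}) \1_E (T (cube_pt q) x) <= delta * n%:R ^+ d) ->
  ocap R T E < eps.
Proof.
move=> [x0 _] eps0 de bound; rewrite /ocap.
set s := (X in lim (X @ \oo)).
(* [lim] is [0] along a divergent sequence, so convergence can be assumed. *)
have [cv|/dvgP ->//] := pselect (cvg (s @ \oo)).
apply: le_lt_trans de; apply: limr_le => //.
(* The successor makes [n] positive, so that n^d is invertible. *)
exists n0.+1 => // n /= n0n; rewrite /s.
have nd : 0 < n%:R ^+ d :> R by rewrite exprn_gt0// ltr0n; lia.
rewrite mulrC ler_pdivrMr//; apply: ge_sup; first by eexists; exists x0.
by move=> _ [x _ <-]; apply: bound; lia.
Qed.

End Dynamics.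

(** * Weights obtained from freeness, minimality and compactness *)

Section Marker.
Context {R : realType} {d : nat} {X : topologicalType}.
Variable T : 'rV[int]_d -> X -> X.
Hypotheses (X_nonempty : [set: X] !=set0) (X_compact : compact [set: X]).
Hypotheses (X_metrizable : metrizable R X) (T_action : Zd_action T).
Hypotheses (T_minimal : minimal_action T) (T_free : free_action T).

(** [g] is a cone supported near a point x0. By freeness, each nonzero n moves a small enough ball
    around x0 off itself, and one radius [eta] serves the finitely many n with |n|^2 at most M. *)
Lemma bump_function (M : nat) :
  exists (g : X -> R) (eta : R), [/\ continuous g,
    forall x, 0 <= g x <= eta, exists x, 0 < g x &
    forall n x, n != 0 -> 0 < g x -> 0 < g (T n x) -> M%:R < sqnorm R n].
Proof.
have [dist [[dist0 distC distD] nbhsE]] := X_metrizable.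
have dist_ge0 x y : 0 <= dist x y.
  have := distD x y x; rewrite [dist y x]distC (dist0 x x).2//; lra.
have distP x e : 0 < e -> \forall y \near x, dist x y < e.
  by move=> e0; suff : nbhs x [set y | dist x y < e] by []; rewrite nbhsE; exists e.
have [x0 _] := X_nonempty.
have escape n : n != 0 -> \forall eta \near (0 : R)^'+,
    forall y, dist x0 y < eta -> eta <= dist x0 (T n y).
  move=> n0; set r := dist x0 (T n x0).
  have r0 : 0 < r.
    rewrite lt_neqAle dist_ge0 andbT eq_sym; apply: contra_neq n0 => /dist0 e.
    by have : [set n | T n x0 = x0] n by []; rewrite T_free.
  have [/(_ n)[Tn _] _ _] := T_action.
  have r2 : 0 < r / 2 by rewrite divr_gt0.
  have : nbhs x0 [set y | dist (T n x0) (T n y) < r / 2].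
    exact: (Tn x0 _ (distP (T n x0) _ r2)).
  rewrite nbhsE => -[e e0 eP].
  near=> eta => y yeta.
  have : dist (T n x0) (T n y) < r / 2.
    by apply: eP => /=; apply: lt_le_trans yeta _; near: eta; exact: nbhs_right_le.
  have : eta <= r / 2 by near: eta; exact: nbhs_right_le.
  have := distD x0 (T n y) (T n x0); rewrite -/r (distC (T n y)); lra.
have [eta eta0 etaP] : exists2 eta : R, 0 < eta &
    forall f : {ffun 'I_d -> 'I_(M.*2.+1)}, box_pt f != 0 ->
    forall y, dist x0 y < eta -> eta <= dist x0 (T (box_pt f) y).
  have : \forall eta \near (0 : R)^'+,
      forall f : {ffun 'I_d -> 'I_(M.*2.+1)}, box_pt f != 0 ->
      forall y, dist x0 y < eta -> eta <= dist x0 (T (box_pt f) y).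
    apply: filter_forall => f.
    have [f0|f0] := eqVneq (box_pt f) 0; first exact: nearW.
    by apply: filterS (escape _ f0) => eta etaP _.
  by move=> /(filterI (nbhs_right_gt 0))/filter_ex[eta []]; exists eta.
have gP x : 0 < Num.max 0 (eta - dist x0 x) -> dist x0 x < eta.
  by rewrite lt_max ltxx/= subr_gt0.
exists (fun x => Num.max 0 (eta - dist x0 x)), eta; split.
- move=> x; apply/cvgrPdist_lt => e e0.
  apply: filterS (distP x e e0) => y; apply: le_lt_trans.
  have := distD x0 x y; have := distD x0 y x; rewrite (distC y x).
  have := dist_ge0 x y.
  case: (lerP 0 (eta - dist x0 x)); case: (lerP 0 (eta - dist x0 y)) => *;
    rewrite ler_norml; apply/andP; split; lra.
- move=> x; rewrite le_max lexx/= ge_max ltW//= gerBl; exact: dist_ge0.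
- by exists x0; rewrite (dist0 x0 x0).2// subr0 lt_max eta0 orbT.
- move=> n x n0 /gP xeta /gP nxeta; rewrite ltNge; apply/negP => nM.
  have [|f nf] := @box_ptP d n M; first by move=> j; exact: sqnorm_coord_le nM.
  by move: n0 nxeta; rewrite nf ltNge => f0 /negP; apply; exact: etaP.
Unshelve. all: by end_near. Qed.

(** The points whose whole orbit avoids {g > 0} form a closed invariant proper subset, empty by
    minimality. By compactness one factor [m] makes m g large enough to cover, and scaling preserves
    {g > 0}, hence the separation. *)
Lemma marker_weight (M : nat) (lam : R) : 0 < lam ->
  exists (g : X -> R) (B : nat), [/\ continuous g,
    forall x, 0 <= g x <= B%:R,
    forall x, exists n, sqnorm R n < lam * g (T n x) &
    forall n x, n != 0 -> 0 < g x -> 0 < g (T n x) -> M%:R < sqnorm R n].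
Proof.
move=> lam0; have [g [eta [gc gb [x0 gx0] gsep]]] := bump_function M.
have [Th T0 TD] := T_action.
have Tc n : continuous (T n) by have [] := Th n.
have gTc n : continuous (g \o T n).
  by move=> x; exact: (continuous_comp (@Tc n x) (@gc _)).
have hit x : exists n, 0 < g (T n x).
  apply: contrapT => no.
  have [] := @T_minimal [set y | forall n, g (T n y) = 0].
  - rewrite [X in closed X](_ : _ = \bigcap_n (g \o T n) @^-1` [set 0]); last first.
      by apply/seteqP; split => [y yP n _|y yP n]; [exact: yP|exact: (yP n I)].
    apply: closed_bigI => n _; apply: closed_comp => [y _|]; first exact: gTc.
    exact: closed_eq.
  - move=> n; apply/seteqP; split => [_ [y yP <-] m|y yP] /=.
      by rewrite -TD; exact: yP.
    by exists (T (- n) y); [move=> m /=; rewrite -TD; exact: yP|rewrite -TD subrr T0].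
  - move/seteqP => [/(_ x) h _]; apply: h => n; apply: contrapT => gn; apply: no.
    by exists n; rewrite lt_neqAle eq_sym; have /andP[-> _] := gb (T n x); rewrite andbT; apply/eqP.
  - move/seteqP => [_ /(_ x0 I)/(_ 0)]; rewrite /= T0 => g0.
    by rewrite g0 ltxx in gx0.
have /compact_near_coveringP cover := X_compact.
have [m [m0 mP]] : exists m : nat, (0 < m)%N /\
    [set: X] `<=` [set x | exists n, sqnorm R n < m%:R * (lam * g (T n x))].
  suff : \forall m \near \oo,
      [set: X] `<=` [set x | exists n, sqnorm R n < m%:R * (lam * g (T n x))].
    by move=> /(filterI (nbhs_infty_gt 0))/filter_ex[m []]; exists m.
  apply: (cover nat \oo (fun m x => exists n, sqnorm R n < m%:R * (lam * g (T n x)))).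
  move=> x _; have [n gn] := hit x.
  (* Halving g (T^n x) leaves a lower bound valid on a neighbourhood of x, so the same n serves
     there. *)
  pose c := lam * (g (T n x) / 2).
  have c0 : 0 < c by rewrite mulr_gt0// divr_gt0.
  exists ([set y | g (T n x) / 2 < g (T n y)], [set m | sqnorm R n / c < m%:R]).
    split => /=.
      by apply: (@cvgr_gt _ _ _ _ _ _ (gTc n x)); rewrite /=; lra.
    exact: nbhs_infty_gtr.
  move=> [y m] [/= gy mc]; exists n.
  rewrite ltr_pdivrMr// in mc; apply: lt_le_trans mc _.
  by rewrite ler_wpM2l// /c ler_pM2l// ltW.
have mR : 0 < m%:R :> R by rewrite ltr0n.
exists (fun x => m%:R * g x), (Num.bound (m%:R * eta)); split.
- by move=> x; apply: cvgM; [exact: cvg_cst|exact: gc].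
- move=> x; have /andP[gx0' gxe] := gb x; rewrite mulr_ge0//=.
  rewrite (le_trans (ler_wpM2l _ gxe))// ltW// archi_boundP// mulr_ge0//.
  exact: le_trans gxe.
- by move=> x; have [n] := mP x I; rewrite mulrCA; exists n.
- by move=> n x n0; rewrite !pmulr_rgt0//; exact: gsep.
Qed.

End Marker.

(** * Choice of the constants and the final estimate *)

Theorem theorem4p2 (R : realType) (d : nat) (hd : (1 <= d)%N)
    (X : topologicalType) (X_nonempty : [set: X] !=set0)
    (X_compact : compact [set: X]) (X_metrizable : metrizable R X)
    (T : 'rV[int]_d -> X -> X) (T_action : Zd_action T)
    (T_minimal : minimal_action T) (T_free : free_action T)
    (eps : R) (eps_gt0 : 0 < eps) (N : nat) (N_ge1 : (1 <= N)%N) :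
  exists Omega : set X,
    [/\ open Omega,
        trivIset [set: {ffun 'I_d -> 'I_N}]
          (fun n => T (- cube_pt n) @` Omega) &
        ocap R T (~` \bigcup_(n in [set: {ffun 'I_d -> 'I_N}])
                       (T (- cube_pt n) @` Omega)) < eps].
Proof.
have [k k_gt1 kd] : exists2 k : nat, (1 < k)%N & d%:R / k%:R < eps / 2.
  exists (Num.bound (d%:R / (eps / 2))).+2 => //.
  rewrite ltr_pdivrMr ?ltr0n// mulrC -ltr_pdivrMr ?divr_gt0//.
  apply: (@lt_le_trans _ _ (Num.bound (d%:R / (eps / 2)))%:R).
    by rewrite archi_boundP// divr_ge0// ltW// divr_gt0.
  by rewrite ler_nat; lia.
pose lam : R := 1 - k%:R^-1.
have lam_gt0 : 0 < lam by rewrite subr_gt0 invf_lt1 ?ltr1n// ltr0n; lia.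
have lam_le1 : lam <= 1 by rewrite gerBl invr_ge0.
(* The separation is the one [power_contract] requires for c = N + 1. The cover holds already for
   the scaled weights lam g, whose cells receive the contracted points. *)
have [g [B [gc gb gcov gsep]]] := marker_weight X_nonempty X_compact X_metrizable
  T_action T_minimal T_free (4 * d * (k * N.+1) ^ 2)%N lam_gt0.
have [_ _ TD] := T_action.
have g_ge0 x : 0 <= g x by have /andP[] := gb x.
have g_le x : g x <= B%:R by have /andP[] := gb x.
have b_le x w : lam * g (T w x) <= B%:R.
  by apply: le_trans (g_le (T w x)); rewrite ler_piMl.
exists (tower_base T g lam N); split.
- rewrite (_ : tower_base T g lam N =
      \bigcup_(u in [set u : 'rV[int]_d | forall j, (N%:Z %| u 0%R j)%Z])
      [set x | forall c : {ffun 'I_d -> 'I_N},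
        in_cell (fun w => lam * g (T w x)) u (- cube_pt c)]); last first.
    by apply/seteqP; split => x [u uN cu]; exists u.
  apply: bigcup_open => u _; rewrite openE => x xu; apply: filter_forall => c.
  apply: open_nbhs_nbhs; split; last exact: xu.
  exact: (open_in_cell T_action gcov gc b_le).
- exact: trivIset_tower.
- pose D := (d * (B + k).*2)%N.
  (* Collisions cost at most eps/2 and the boundary of the box at most eps/4 for these [n]; the rest
     of eps gives strictness in the limit. *)
  apply: (@ocap_lt _ _ _ _ _ (3 / 4 * eps) _ (Num.bound (D%:R / (eps / 4))).+1) => //.
    lra.
  move=> n x nD.
  have n_gt0 : (0 < n)%N by lia.
  have nR : 0 < n%:R :> R by rewrite ltr0n.
  have := @card_not_deep R d (fun w => g (T w x)) k N B k_gt1 N_ge1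
    (fun w => g_ge0 _) (fun w => g_le _) (power_cover T_action gcov x) _ n n_gt0.
  have sep u v : 0 < g (T u x) -> 0 < g (T v x) -> u != v ->
      4 * d%:R * (k%:R * N.+1%:R) ^+ 2 < sqnorm R (u - v).
    move=> gu gv uv; have := @gsep (u - v) (T v x).
    rewrite -TD subrK subr_eq0 => /(_ uv gv gu).
    by rewrite !(natrM, natrX).
  move=> /(_ sep) card.
  have DR : D%:R / n%:R < eps / 4.
    rewrite ltr_pdivrMr// mulrC -ltr_pdivrMr ?divr_gt0//.
    apply: (@lt_le_trans _ _ (Num.bound (D%:R / (eps / 4)))%:R).
      by rewrite archi_boundP// divr_ge0// ltW// divr_gt0.
    by rewrite ler_nat; lia.
  apply: (@le_trans _ _ ((d%:R / k%:R + D%:R / n%:R) * n%:R ^+ d)); last first.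
    by rewrite ler_wpM2r ?exprn_ge0//; lra.
  apply: le_trans card; rewrite -sum1_card natr_sum [leRHS]big_mkcond/=.
  (* Termwise: if T^q x is outside the tower, then [q] is not deep in the diagram of [x]. *)
  apply: ler_sum => q _; rewrite indicE inE.
  case: asboolP => /= [[u uq]|_]; last by rewrite lern1 leq_b1.
  have xA := deep_in_tower T_action N_ge1 (deep_shift T_action uq).
  by rewrite memNset// => /(_ xA).
Qed.
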